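(* A class $\mathcal{C}$ of finite split graphs is $\mathrm{MSO}_2$-orderable if, and only if, there is $s\in\mathbb{N}$ such that $\mathcal{C}$ has property $\mathsf{SEP}(f)$ for the function $f(n)=2^{s(n+1)}$.
   Context: A split graph is a graph whose vertex set can be partitioned into a set inducing a clique and an independent set. For $G=\langle V,E\rangle$, $\lceil G\rceil=\langle V\cup E,\mathrm{inc}\rangle$ (universe $V\cup E$, incidence relation). An MSO-formula $\varphi(x,y;Z_0,\dots,Z_{k-1})$ defines an order on a class $\mathcal{K}$ of structures if for every non-empty $\mathfrak{A}\in\mathcal{K}$ there are $P_0,\dots,P_{k-1}\subseteq A$ with $\{(a,b):\mathfrak{A}\models\varphi(a,b;\bar P)\}$ a linear order on $A$; a graph class is $\mathrm{MSO}_2$-orderable if some MSO-formula defines an order on $\{\lceil G\rceil\}$. $\mathrm{Sep}(G,k)$ is the maximum over vertex sets $S$, $|S|\le k$, of the number of connected components of $G-S$; $\mathcal{C}$ has $\mathsf{SEP}(f)$ if $\mathrm{Sep}(G,k)\le f(k)$ for all $G\in\mathcal{C}$ and all $k$. *)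

(* Defs.v *)
From mathcomp Require Import all_boot.
Set Implicit Arguments. Unset Strict Implicit. Unset Printing Implicit Defensive.

Record sgraph : Type := SGraph {
  gn : nat;
  gadj : rel 'I_gn;
  gsym : symmetric gadj;
  girr : irreflexive gadj }.
Arguments gadj : clear implicits.

Definition is_split (G : sgraph) : Prop :=
  exists (K I : {set 'I_(gn G)}),
    [/\ K :&: I = set0, K :|: I = setT,
        (forall x y, x \in K -> y \in K -> x != y -> gadj G x y) &
        (forall x y, x \in I -> y \in I -> ~~ gadj G x y)].

Definition del_rel (G : sgraph) (S : {set 'I_(gn G)}) : rel 'I_(gn G) :=
  fun x y => [&& gadj G x y, x \notin S & y \notin S].

Definition ncomp_del (G : sgraph) (S : {set 'I_(gn G)}) : nat :=
  n_comp (del_rel S) (~: S).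

Definition Sep (G : sgraph) (k : nat) : nat :=
  \max_(S : {set 'I_(gn G)} | #|S| <= k) ncomp_del S.

Definition has_SEP (C : sgraph -> Prop) (f : nat -> nat) : Prop :=
  forall G, C G -> forall k, Sep G k <= f k.

Definition is_edge (G : sgraph) (e : {set 'I_(gn G)}) : bool :=
  [exists x, exists y, gadj G x y && (e == [set x; y])].

Definition inc_univ (G : sgraph) : finType :=
  ('I_(gn G) + {e : {set 'I_(gn G)} | is_edge e})%type.

Definition inc_rel (G : sgraph) : rel (inc_univ G) :=
  fun a b => match a, b with
             | inl v, inr e => v \in val e
             | _, _ => false
             end.

Inductive mso : Type :=
| MRel (x y : nat)
| MEq (x y : nat)
| MIn (x X : nat)
| MNot (f : mso)
| MAnd (f g : mso)
| MOr (f g : mso)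
| MEx1 (x : nat) (f : mso)
| MAll1 (x : nat) (f : mso)
| MEx2 (X : nat) (f : mso)
| MAll2 (X : nat) (f : mso).

Definition upd {A : Type} (env : nat -> A) (i : nat) (a : A) : nat -> A :=
  fun j => if j == i then a else env j.

Fixpoint msat (U : finType) (R : rel U) (e1 : nat -> U) (e2 : nat -> {set U})
  (f : mso) : Prop :=
  match f with
  | MRel x y => R (e1 x) (e1 y)
  | MEq x y => e1 x = e1 y
  | MIn x X => e1 x \in e2 X
  | MNot g => ~ msat R e1 e2 g
  | MAnd g h => msat R e1 e2 g /\ msat R e1 e2 h
  | MOr g h => msat R e1 e2 g \/ msat R e1 e2 h
  | MEx1 x g => exists u : U, msat R (upd e1 x u) e2 g
  | MAll1 x g => forall u : U, msat R (upd e1 x u) e2 g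
  | MEx2 X g => exists S : {set U}, msat R e1 (upd e2 X S) g
  | MAll2 X g => forall S : {set U}, msat R e1 (upd e2 X S) g
  end.

Fixpoint mso_wf (b1 b2 : nat -> bool) (f : mso) : bool :=
  match f with
  | MRel x y | MEq x y => b1 x && b1 y
  | MIn x X => b1 x && b2 X
  | MNot g => mso_wf b1 b2 g
  | MAnd g h | MOr g h => mso_wf b1 b2 g && mso_wf b1 b2 h
  | MEx1 x g | MAll1 x g => mso_wf (fun j => (j == x) || b1 j) b2 g
  | MEx2 X g | MAll2 X g => mso_wf b1 (fun j => (j == X) || b2 j) g
  end.

(* phi(x,y;Z_0..Z_{k-1}): free FO vars among 0 (= x), 1 (= y);
   free set vars among 0..k-1 (= Z_0..Z_{k-1}) *)
Definition mso_formula_xyZ (k : nat) (phi : mso) : bool :=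
  mso_wf (fun j => j < 2) (fun j => j < k) phi.

Definition linear_order (U : finType) (r : U -> U -> Prop) : Prop :=
  [/\ (forall a b, r a b -> r b a -> a = b),
      (forall a b c, r a b -> r b c -> r a c) &
      (forall a b, r a b \/ r b a)].

Definition two_env (U : finType) (a b : U) : nat -> U :=
  fun j => if j == 0 then a else b.

(* phi defines an order on the structure (U,R), using set parameters P_0..P_{k-1} *)
Definition defines_order_on (k : nat) (phi : mso) (U : finType) (R : rel U) : Prop :=
  exists P : nat -> {set U},
    linear_order (fun a b => msat R (two_env a b) P phi).

Definition MSO2_orderable (C : sgraph -> Prop) : Prop :=
  exists (k : nat) (phi : mso), mso_formula_xyZ k phi /\
    forall G, C G -> 0 < #|inc_univ G| -> defines_order_on k phi (@inc_rel G).

(* Main.v *)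
Require Import Defs.
From mathcomp Require Import all_boot zify.
Set Implicit Arguments. Unset Strict Implicit. Unset Printing Implicit Defensive.

(** Let G be split with clique K and stable set I.

    From an order to SEP: all components of G - S but one are single vertices of
    I with neighbourhood inside S.  Relative to k parameters, such a vertex is
    described by one subset of a set of size (k+1)(|S|+1): its colours, its
    neighbours, and the colours of its edges.  Two vertices with the same
    description are exchanged by an automorphism of the coloured incidence
    structure, so no formula can order them.

    From SEP to an order: the vertices with neighbourhood S are isolated in
    G - S, so there are at most 2^(s(|S|+1)) of them, and s colours on vertices
    and edges tell them apart.  A Hamiltonian path of K, given as an edge set,
    orders K; everything else is then ordered lexicographically along K. *)

(** * Decidability of MSO satisfaction and its invariance under automorphisms *)

(** All quantifiers range over finite types. This lets [fimp], a disjunction, be read as implication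
    without classical axioms. *)
Lemma msat_decidable (U : finType) (R : rel U) f e1 e2 :
  exists b : bool, b <-> msat R e1 e2 f.
Proof.
elim: f e1 e2 => [x y|x y|x X|f IH|f IHf g IHg|f IHf g IHg|x f IH|x f IH|X f IH|X f IH] e1 e2 /=.
- by exists (R (e1 x) (e1 y)).
- by exists (e1 x == e1 y); split=> /eqP.
- by exists (e1 x \in e2 X).
- have [b hb] := IH e1 e2; exists (~~ b); rewrite -hb; split; by move/negP.
- have [b hb] := IHf e1 e2; have [c hc] := IHg e1 e2.
  by exists (b && c); rewrite -hb -hc; split=> /andP.
- have [b hb] := IHf e1 e2; have [c hc] := IHg e1 e2.
  by exists (b || c); rewrite -hb -hc; split=> /orP.
- have [g hg] := fin_all_exists (fun u => IH (upd e1 x u) e2).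
  by exists [exists u, g u]; split=> [/existsP[u /hg]|[u /hg gu]];
    [exists u | apply/existsP; exists u].
- have [g hg] := fin_all_exists (fun u => IH (upd e1 x u) e2).
  by exists [forall u, g u]; split=> [/forallP h u|h];
    [apply/hg/h | apply/forallP=> u; apply/hg/h].
- have [g hg] := fin_all_exists (fun S => IH e1 (upd e2 X S)).
  by exists [exists S, g S]; split=> [/existsP[u /hg]|[u /hg gu]];
    [exists u | apply/existsP; exists u].
- have [g hg] := fin_all_exists (fun S => IH e1 (upd e2 X S)).
  by exists [forall S, g S]; split=> [/forallP h u|h];
    [apply/hg/h | apply/forallP=> u; apply/hg/h].
Qed.

Definition fimp f g := MOr (MNot f) g.

Lemma msat_imp (U : finType) (R : rel U) e1 e2 f g :
  msat R e1 e2 (fimp f g) <-> (msat R e1 e2 f -> msat R e1 e2 g).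
Proof.
have [b hb] := msat_decidable R f e1 e2.
split=> [[nf /nf|//]|h] //=.
by case: b hb => hb; [right; apply/h/hb | left=> /hb].
Qed.

Section MsatUnfold.
Variables (U : finType) (R : rel U) (e1 : nat -> U) (e2 : nat -> {set U}).

Lemma msat_rel x y : msat R e1 e2 (MRel x y) = R (e1 x) (e1 y).
Proof. by []. Qed.
Lemma msat_eq x y : msat R e1 e2 (MEq x y) = (e1 x = e1 y).
Proof. by []. Qed.
Lemma msat_in x X : msat R e1 e2 (MIn x X) = (e1 x \in e2 X).
Proof. by []. Qed.
Lemma msat_not f : msat R e1 e2 (MNot f) = (~ msat R e1 e2 f).
Proof. by []. Qed.
Lemma msat_and f g : msat R e1 e2 (MAnd f g) = (msat R e1 e2 f /\ msat R e1 e2 g).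
Proof. by []. Qed.
Lemma msat_or f g : msat R e1 e2 (MOr f g) = (msat R e1 e2 f \/ msat R e1 e2 g).
Proof. by []. Qed.
Lemma msat_ex1 x f :
  msat R e1 e2 (MEx1 x f) = (exists u, msat R (upd e1 x u) e2 f).
Proof. by []. Qed.
Lemma msat_all1 x f :
  msat R e1 e2 (MAll1 x f) = (forall u, msat R (upd e1 x u) e2 f).
Proof. by []. Qed.
Lemma msat_all2 X f :
  msat R e1 e2 (MAll2 X f) = (forall S, msat R e1 (upd e2 X S) f).
Proof. by []. Qed.

End MsatUnfold.

(** Disjunction is left out on purpose: [fimp] is one, and is read through [msat_imp]. *)
Definition msatE :=
  (msat_rel, msat_eq, msat_in, msat_not, msat_and, msat_ex1, msat_all1).

Lemma eq_upd_imset (A B : Type) (h : A -> B) (e : nat -> A) (e' : nat -> B)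
    (b : nat -> bool) x u :
  (forall j, b j -> e' j = h (e j)) ->
  forall j, (j == x) || b j -> upd e' x (h u) j = h (upd e x u j).
Proof. by move=> he j; rewrite /upd; case: eqP => //= _ /he. Qed.

(** Induction on the formula. As [h] is its own inverse, every quantified element or set is the
    image of one, so quantifiers are reindexed along [h]. *)
Lemma msat_automorphism (U : finType) (R : rel U) (h : U -> U) :
  involutive h -> (forall u v, R (h u) (h v) = R u v) ->
  forall f b1 b2 e1 (e2 : nat -> {set U}) e1' e2', mso_wf b1 b2 f ->
    (forall j, b1 j -> e1' j = h (e1 j)) ->
    (forall j, b2 j -> e2' j = h @: e2 j) ->
  msat R e1 e2 f <-> msat R e1' e2' f.
Proof.
move=> hK hR; have hSK (S : {set U}) : h @: (h @: S) = S.
  by rewrite -imset_comp (eq_imset _ hK) imset_id.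
elim=> [x y|x y|x X|f IH|f IHf g IHg|f IHf g IHg|x f IH|x f IH|X f IH|X f IH]
  b1 b2 e1 e2 e1' e2' /=.
- by case/andP=> bx by_ h1 h2; rewrite !h1 // hR.
- by case/andP=> bx by_ h1 h2; rewrite !h1 //; split=> [->//|/(inv_inj hK)].
- by case/andP=> bx bX h1 h2; rewrite h1 // h2 // mem_imset //; apply: inv_inj.
- by move=> w h1 h2; rewrite (IH _ _ _ _ _ _ w h1 h2).
- by case/andP=> wf wg h1 h2; rewrite (IHf _ _ _ _ _ _ wf h1 h2) (IHg _ _ _ _ _ _ wg h1 h2).
- by case/andP=> wf wg h1 h2; rewrite (IHf _ _ _ _ _ _ wf h1 h2) (IHg _ _ _ _ _ _ wg h1 h2).
- move=> w h1 h2; have E u := IH _ _ _ _ _ _ w (eq_upd_imset u h1) h2.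
  by split=> [[u /E]|[u]]; [exists (h u) | rewrite -[u]hK => /E; exists (h u)].
- move=> w h1 h2; have E u := IH _ _ _ _ _ _ w (eq_upd_imset u h1) h2.
  by split=> H u; [rewrite -[u]hK; apply/E/H | apply/E/H].
- move=> w h1 h2.
  have E S := IH _ _ _ _ _ _ w h1 (eq_upd_imset (h := fun S : {set U} => h @: S) S h2).
  by split=> [[u /E]|[u]]; [exists (h @: u) | rewrite -[u]hSK => /E; exists (h @: u)].
- move=> w h1 h2.
  have E S := IH _ _ _ _ _ _ w h1 (eq_upd_imset (h := fun S : {set U} => h @: S) S h2).
  by split=> H u; [rewrite -[u]hSK; apply/E/H | apply/E/H].
Qed.

(** * Components of a split graph after deleting a vertex set *)

Lemma del_rel_connect_sym (G : sgraph) (S : {set 'I_(gn G)}) :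
  connect_sym (del_rel S).
Proof.
by apply: sym_connect_sym => x y; rewrite /del_rel gsym [RHS]andbCA andbC -!andbA andbC -andbA.
Qed.

Section Split.
Variables (G : sgraph) (K I : {set 'I_(gn G)}).
Hypotheses (KI0 : K :&: I = set0) (KIT : K :|: I = setT).
Hypothesis Kclique : forall x y, x \in K -> y \in K -> x != y -> gadj G x y.
Hypothesis Istable : forall x y, x \in I -> y \in I -> ~~ gadj G x y.

Let V := 'I_(gn G).

Lemma in_stable_part x : (x \in I) = (x \notin K).
Proof.
have /setP/(_ x) := KI0; have /setP/(_ x) := KIT; rewrite !inE.
by case: (x \in K); case: (x \in I).
Qed.

Definition nbhd (v : V) : {set V} := [set x | gadj G v x].

(** What is left of the clique is connected, so at most one component meets it; any other component
    is a single stable vertex with all its neighbours in [S]. *)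
Lemma ncomp_del_le (S : {set V}) :
  ncomp_del S <= (#|[set v in I | (v \notin S) && (nbhd v \subset S)]|).+1.
Proof.
set A := [set v in I | _]; rewrite /ncomp_del /n_comp_mem.
set X := predI _ _; rewrite -(cardID A X).
suff: #|[predD X & A]| <= 1.
  by move=> h; rewrite -addn1 leq_add // subset_leq_card //; apply/subsetP=> x /andP[].
have reachK x : x \in [predD X & A] ->
    [/\ x \in roots (del_rel S), x \notin S &
     exists2 y, y \in K :\: S & connect (del_rel S) x y].
  rewrite !inE => /and3P[nA rx xS]; split=> //.
  case xK: (x \in K); first by exists x; rewrite ?inE ?xK ?xS.
  (* A stable vertex outside [S] and [A] has a neighbour outside [S], which lies in [K] by stability
     of [I]. *)
  move: nA; rewrite in_stable_part xK xS /= => /subsetPn[y].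
  rewrite inE => xy yS; exists y; last by rewrite connect1 // /del_rel xy xS.
  rewrite inE yS /=; apply: contraTT xy; rewrite -in_stable_part => yI.
  by apply: Istable; rewrite // in_stable_part xK.
apply/card_le1_eqP => x y /reachK[rx xS [x' xK cx]] /reachK[ry yS [y' yK cy]].
rewrite -(eqP rx) -(eqP ry); apply/esym/(rootP (@del_rel_connect_sym _ S)).
apply: connect_trans cx _; rewrite del_rel_connect_sym.
apply: connect_trans cy _; have [->//|ne] := eqVneq y' x'.
by move: xK yK; rewrite !inE => /andP[xs xK] /andP[ys yK];
  rewrite connect1 // /del_rel Kclique // xs ys.
Qed.

(** Such a vertex is outside [S], as there are no loops, and is isolated in G - S; so it is the root
    of its own component. *)
Lemma twins_le_ncomp_del (S : {set V}) :
  #|[set v | nbhd v == S]| <= ncomp_del S.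
Proof.
apply/subset_leq_card/subsetP=> v; rewrite !inE => /eqP vS.
have vnS : v \notin S by rewrite -vS inE girr.
rewrite vnS andbT; apply/eqP.
have /connectP[[|y p] /=] := connect_root (del_rel S) v; first by [].
by rewrite /del_rel -vS !inE => /andP[/and3P[-> _]].
Qed.

End Split.

(** * Binary values and lexicographic orders *)

(** The most significant bit comes first, so comparing values compares sequences
    lexicographically. *)
Fixpoint bitval (s : bitseq) : nat :=
  if s is b :: s' then b * 2 ^ size s' + bitval s' else 0.

Lemma bitval_lt s : bitval s < 2 ^ size s.
Proof. by elim: s => //= b s IH; rewrite expnS; case: b => /=; lia. Qed.

Lemma bitval_inj s t : size s = size t -> bitval s = bitval t -> s = t.
Proof.
elim: s t => [|b s IH] [|c t] //= [st]; rewrite st => e.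
have := bitval_lt s; have := bitval_lt t; rewrite st => ls lt.
suff ebc : b = c by congr (_ :: _) => //; apply: IH => //; subst; lia.
by move: e; case: b; case: c => //=; lia.
Qed.

(** The first difference decides. Stated without mentioning a first difference, this is the
    condition that [flexK] expresses. *)
Lemma bitval_leP s t : size s = size t ->
  bitval s <= bitval t <->
  forall i, nth false s i -> ~~ nth false t i ->
    exists2 j, j < i & nth false t j && ~~ nth false s j.
Proof.
elim: s t => [|b s IH] [|c t] //=; first by split=> // _ [|i].
move=> [st]; have := bitval_lt s; have := bitval_lt t; rewrite st => ls lt.
have [<-|ne] := eqVneq b c.
  rewrite leq_add2l IH //; split=> H.
    by case=> [|i] /=; [case: b | move=> /H/[apply] -[j ? ?]; exists j.+1].
  by move=> i si ti; have [[|j] //= ji tj] := H i.+1 si ti; [case: (b) tj | exists j].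
(* With different heads, position 0 decides. *)
case: b c ne => [] [] //= _.
  by split=> [|/(_ 0 isT isT) [] //]; lia.
split=> [_|_]; last by lia.
by case=> [//|i] _ _; exists 0.
Qed.

Section LexOrder.
Variables (U : finType) (T : Type) (F : T -> U -> nat).

Fixpoint lexF (cs : seq T) (a b : U) : bool :=
  if cs is c :: cs' then
    (F c a <= F c b) && ((F c b <= F c a) ==> lexF cs' a b) else true.

(** Numeric keys always give a total preorder; separation of points is needed for antisymmetry
    alone. *)
Lemma lexF_linear cs :
  (forall a b, all (fun c => F c a == F c b) cs -> a = b) ->
  linear_order (fun a b => lexF cs a b : Prop).
Proof.
move=> inj; split.
- move=> a b ab ba; apply: inj; elim: cs ab ba => //= c cs IH.
  by move=> /andP[le1 /implyP h1] /andP[le2 /implyP h2];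
    rewrite eqn_leq le1 le2 /= IH ?h1 ?h2.
- move=> a b d; elim: (cs) => //= c l IH.
  move=> /andP[le1 /implyP h1] /andP[le2 /implyP h2].
  rewrite (leq_trans le1 le2); apply/implyP=> le3.
  by apply: IH; [apply: h1 | apply: h2]; lia.
- move=> a b; elim: (cs) => [|c l [IH|IH]] /=; first by left.
    by case: (ltngtP (F c a) (F c b)) => _ /=; by [left|right|left].
  by case: (ltngtP (F c a) (F c b)) => _ /=; by [left|right|right].
Qed.

End LexOrder.

(** * The formulas that make up the order *)

(* Parameters: [Z_0] is the edge set of a Hamiltonian path of the clique, [Z_1]
   the start of that path, [Z_2] the vertex set of the clique; [Z_3] is kept
   for the bound set variable of [fleK], and [Z_4, Z_5, ...] are the colours
   of vertices and edges. *)
Definition fadj u w := MEx1 6 (MAnd (MIn 6 0) (MAnd (MRel u 6) (MRel w 6))).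

(* [x] precedes [y] on the path iff a walk from the start reaches [x] without
   ever continuing past [y]. *)
Definition fleK x y :=
  MAll2 3 (fimp
    (MAnd (MAll1 4 (fimp (MIn 4 1) (MIn 4 3)))
          (MAll1 4 (MAll1 5 (fimp (MIn 4 3) (fimp (MNot (MEq 4 y))
             (fimp (fadj 4 5) (MIn 5 3)))))))
    (MIn x 3)).

(* Of two subsets of K, the one containing the first point of their symmetric
   difference is the larger. *)
Definition flexK (T : nat -> nat -> mso) a b :=
  MAll1 2 (fimp (MIn 2 2) (fimp (T a 2) (fimp (MNot (T b 2))
    (MEx1 3 (MAnd (MIn 3 2) (MAnd (MNot (fleK 2 3))
                                  (MAnd (T b 3) (MNot (T a 3))))))))).

Definition fedge a := MEx1 9 (MRel 9 a).
(** Attaches to [a] a stable vertex: [a] itself, or the stable end of a crossing edge. The colour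
    criteria thus serve vertices and edges alike. *)
Definition fstable v a :=
  MAnd (MOr (MEq v a) (MRel v a)) (MAnd (MNot (fedge v)) (MNot (MIn v 2))).
Definition fvcol j a := MEx1 7 (MAnd (fstable 7 a) (MIn 7 (4 + j))).
Definition fecol j a x := MEx1 7 (MEx1 8
  (MAnd (fstable 7 a) (MAnd (MRel 7 8) (MAnd (MRel x 8) (MIn 8 (4 + j)))))).
(** As [x] runs over the clique, this identifies a clique vertex, or lists the ends of an edge in
    the clique. *)
Definition fend a x := MOr (MEq x a) (MRel x a).

Inductive crit := CEdge | CEnd | CVCol of nat | CECol of nat.

Definition fcrit c a b :=
  match c with
  | CEdge => fimp (fedge a) (fedge b)
  | CEnd => flexK fend a b
  | CVCol j => fimp (fvcol j a) (fvcol j b)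
  | CECol j => flexK (fecol j) a b
  end.

(** Lexicographic combination: later criteria matter only on ties. [MEq 0 0] stands for truth. *)
Definition flex (cs : seq crit) :=
  foldr (fun c f => MAnd (fcrit c 0 1) (fimp (fcrit c 1 0) f)) (MEq 0 0) cs.

Definition crits s :=
  CEdge :: CEnd :: flatten [seq [:: CVCol j; CECol j] | j <- iota 0 s].

Lemma crits_wf s : mso_formula_xyZ (4 + s) (flex (crits s)).
Proof.
rewrite /mso_formula_xyZ /crits /= !addSn add0n /=.
have : all (fun j => j < s) (iota 0 s) by apply/allP=> j; rewrite mem_iota.
by elim: (iota 0 s) => //= j l IH /andP[js /IH ->]; rewrite !addSn !add0n !ltnS js.
Qed.

(** * Meaning of the formulas, with [ks] listing the clique along the path *)

Section Semantics.
Arguments msat : simpl never.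

Variables (U : finType) (R : rel U) (P : nat -> {set U}) (ks : seq U).
Hypothesis ks_uniq : uniq ks.
Hypothesis inP2 : forall u, (u \in P 2) = (u \in ks).
Hypothesis inP1 : forall u, (u \in P 1) = (u \in ks) && (index u ks == 0).
Hypothesis path_le : forall e u w, e \in P 0 -> R u e -> R w e ->
  w \in ks /\ index w ks <= (index u ks).+1.
Hypothesis path_step : forall u w, u \in ks -> w \in ks ->
  index w ks = (index u ks).+1 -> exists e, [/\ e \in P 0, R u e & R w e].

(** The segment up to [y] satisfies the closure conditions; conversely every set satisfying them
    contains that segment. The bounds on [x] and [y] avoid capture by the bound variables 4, 5 and
    6. *)
Lemma msat_fleK e1 x y : x < 4 -> y < 4 -> e1 x \in ks -> e1 y \in ks ->
  msat R e1 P (fleK x y) <-> index (e1 x) ks <= index (e1 y) ks.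
Proof.
move=> x4 y4 xk yk; have xE i : x == i.+4 = false by lia.
have yE i : y == i.+4 = false by lia.
rewrite /fleK msat_all2; split.
  (* Instantiate the set variable with the initial segment ending at [y]. *)
  move=> /(_ [set u in ks | index u ks <= index (e1 y) ks])/msat_imp.
  rewrite msat_in /upd /= inE xk; apply; rewrite !msatE; split=> u.
    by apply/msat_imp; rewrite !msatE /upd /= inE inP1 => /andP[-> /eqP ->].
  rewrite msatE => w; apply/msat_imp=> h1; apply/msat_imp=> h2; apply/msat_imp=> h3; move: h1 h2 h3.
  rewrite !msatE /upd /= !yE !inE => /andP[uk ule] ne [e].
  rewrite !msatE /= => -[e0 [ue we]]; have [-> wle] := path_le e0 ue we.
  apply: leq_trans wle _; rewrite ltn_neqAle ule andbT; apply/eqP=> e'.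
  by apply: ne; rewrite -(nth_index u uk) e' nth_index.
move=> le X; apply/msat_imp; rewrite !msatE => -[root step].
have step' u w e : u \in X -> u != e1 y -> e \in P 0 -> R u e -> R w e -> w \in X.
  move=> uX ne e0 ue we; have := step u; rewrite msatE => /(_ w)/msat_imp.
  rewrite !msatE /upd /= => /(_ uX)/msat_imp; rewrite !msatE /= !yE.
  by move=> /(_ (elimN eqP ne))/msat_imp; apply; exists e; rewrite !msatE.
rewrite /upd /=; have [i ui] : exists i, index (e1 x) ks = i by eexists.
rewrite ui in le; elim: i (e1 x) xk ui le => [|i IH] u uk ui le.
  by have /msat_imp := root u; apply; rewrite msatE /= inP1 uk ui.
have ik : i.+1 < size ks by rewrite -ui index_mem.
(* [w] is the predecessor of [u] on the path; it comes strictly before [y], so the walk may continue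
   from it. *)
pose w := nth u ks i; have wi : index w ks = i by rewrite index_uniq // ltnW.
have wk : w \in ks by rewrite mem_nth // ltnW.
have [|e [e0 we ue]] := path_step wk uk; first by rewrite wi.
apply: (step' w u e) => //; first by apply: IH; rewrite // ltnW.
by apply: contraTneq le => <-; rewrite wi ltnn.
Qed.

(** A subset of the clique coded as a number, earlier path vertices weighing more. *)
Definition keyK (t : U -> U -> bool) u := bitval [seq t u x | x <- ks].

(** This is [bitval_leP] with bit positions replaced by the clique vertices at those positions. *)
Lemma msat_flexK T (t : U -> U -> bool) :
  (forall e1 a x, a < 2 -> x \in [:: 2; 3] ->
     msat R e1 P (T a x) <-> t (e1 a) (e1 x)) ->
  forall e1 a b, a < 2 -> b < 2 ->
    msat R e1 P (flexK T a b) <-> keyK t (e1 a) <= keyK t (e1 b).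
Proof.
move=> hT e1 a b a2 b2; rewrite /keyK bitval_leP ?size_map // /flexK.
have nek i : (a == i.+2 = false) /\ (b == i.+2 = false) by lia.
have [[aE2 bE2] [aE3 bE3]] := (nek 0, nek 1).
have nthE u i x : i < size ks -> nth false [seq t u x | x <- ks] i = t u (nth x ks i).
  by move=> ik; apply: nth_map.
rewrite msat_all1; split=> [H i|H x].
  (* Beyond the end the default bit is [false], so the premise fails. *)
  have [ik|ik] := ltnP i (size ks); last by rewrite nth_default ?size_map.
  have /(_ (nth (e1 0) ks i)) := H; set x := nth _ ks i.
  have xk : x \in ks by apply: mem_nth.
  rewrite !(nthE _ _ (e1 0)) // -/x => h tax /negP tbx.
  have /msat_imp := h; rewrite msatE {1}/upd /= inP2 => /(_ xk)/msat_imp.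
  rewrite hT // /upd /= aE2 => /(_ tax)/msat_imp; rewrite msatE hT //= bE2.
  move=> /(_ tbx); rewrite msatE => -[z]; rewrite !msatE {1}/upd /= inP2 => -[zk [lt []]].
  rewrite !hT // /= /upd /= aE2 aE3 bE2 bE3 => tbz /negP taz.
  exists (index z ks).
    move: lt; rewrite msat_fleK //=.
    by move/negP; rewrite -ltnNge /upd /= /x index_uniq.
  by rewrite !(nthE _ _ z) ?index_mem // nth_index // tbz.
apply/msat_imp=> h1; apply/msat_imp=> h2; apply/msat_imp=> h3; move: h1 h2 h3.
rewrite !msatE /upd /= !hT // /= aE2 bE2 inP2 => xk tax /negP tbx.
have ik : index x ks < size ks by rewrite index_mem.
have [||j ji] := H (index x ks); do ?by rewrite (nthE _ _ x) ?nth_index.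
have jk := ltn_trans ji ik; rewrite !(nthE _ _ x) // => /andP[tbz taz].
exists (nth x ks j); rewrite !msatE !hT //= ?aE2 ?bE2 ?aE3 ?bE3.
rewrite {1}inP2 mem_nth; last by [].
split=> //; split; last by split=> //; apply/negP.
by rewrite msat_fleK //= ?mem_nth // index_uniq //; apply/negP; rewrite -ltnNge.
Qed.

Definition bedge a := [exists y, R y a].
Definition bstable v a := [&& (v == a) || R v a, ~~ bedge v & v \notin P 2].
Definition bvcol j a := [exists v, bstable v a && (v \in P (4 + j))].
Definition becol j a x :=
  [exists v, exists e, [&& bstable v a, R v e, R x e & e \in P (4 + j)]].
Definition bend a x := (x == a) || R x a.

Lemma msat_fedge e1 a : a != 9 -> msat R e1 P (fedge a) <-> bedge (e1 a).
Proof.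
move=> /negPf a9; rewrite /fedge msatE.
by split=> [[y]|/existsP[y ya]]; [rewrite msatE /upd /= a9 => ya; apply/existsP|]; exists y; rewrite ?msatE /upd /= ?a9.
Qed.

Lemma msat_fstable e1 v a : v != 9 -> a != 9 ->
  msat R e1 P (fstable v a) <-> bstable (e1 v) (e1 a).
Proof.
move=> v9 a9; rewrite /fstable msat_and msat_or msat_and !msat_not msat_eq msat_rel msat_in msat_fedge // /bstable.
split=> [[va [ne nk]]|/and3P[va /negP ne /negP nk]].
  by rewrite (introN idP ne) (introN idP nk) !andbT; apply/orP; case: va => [->|->]; rewrite ?eqxx; [left|right].
by split=> //; case/orP: va => [/eqP|]; [left|right].
Qed.

Lemma msat_fvcol j e1 a : a < 2 -> msat R e1 P (fvcol j a) <-> bvcol j (e1 a).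
Proof.
move=> a2; have aE i : a == i.+2 = false by lia.
rewrite /fvcol msatE; split=> [[v]|/existsP[v /andP[va vj]]].
  rewrite msat_and msat_in msat_fstable ?aE // /upd /= aE => -[va vj].
  by apply/existsP; exists v; rewrite va.
exists v; rewrite msat_and msat_in msat_fstable ?aE //.
by rewrite /upd /= aE.
Qed.

Lemma msat_fecol j e1 a x : a < 2 -> x \in [:: 2; 3] ->
  msat R e1 P (fecol j a x) <-> becol j (e1 a) (e1 x).
Proof.
move=> a2 x23; have aE i : a == i.+2 = false by lia.
have xE i : x == i.+4 = false by move: x23; rewrite !inE; lia.
have E v e : msat R (upd (upd e1 7 v) 8 e) P (fstable 7 a) <-> bstable v (e1 a).
  by rewrite msat_fstable ?aE // /upd /= !aE.
rewrite /fecol msatE; split=> [[v]|/existsP[v /existsP[e /and4P[va ve xe ej]]]].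
  rewrite msatE => -[e]; rewrite msat_and => -[/E va].
  rewrite !msatE /upd /= !xE => -[ve [xe ej]].
  by apply/existsP; exists v; apply/existsP; exists e; apply/and4P.
exists v; rewrite msatE; exists e; rewrite msat_and; split; first exact/E.
by rewrite !msatE /upd /= !xE.
Qed.

Lemma msat_fend e1 a x : msat R e1 P (fend a x) <-> bend (e1 a) (e1 x).
Proof. by split=> [[->|xa]|/orP[/eqP|]]; rewrite /bend ?eqxx ?xa ?orbT //; [left|right]. Qed.

Definition key c u : nat :=
  match c with
  | CEdge => bedge u
  | CEnd => keyK bend u
  | CVCol j => bvcol j u
  | CECol j => keyK (becol j) u
  end.

(** For 0/1 keys, implication is the comparison of numbers. *)
Lemma msat_fcrit c e1 a b : a < 2 -> b < 2 ->
  msat R e1 P (fcrit c a b) <-> key c (e1 a) <= key c (e1 b).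
Proof.
move=> a2 b2; have imp (x y : bool) : (x -> y) <-> x <= y.
  by case: x y => [] []; split=> // /(_ isT).
case: c => [||j|j] /=.
- by rewrite -imp -!(@msat_fedge e1) ?msat_imp //; lia.
- by apply: msat_flexK => // *; apply: msat_fend.
- by rewrite -imp -!(@msat_fvcol j e1) ?msat_imp.
- by apply: msat_flexK => // *; apply: msat_fecol.
Qed.

Lemma msat_flex cs a b : msat R (two_env a b) P (flex cs) <-> lexF key cs a b.
Proof.
elim: cs => //= c cs IH; rewrite msat_and msat_imp !msat_fcrit // IH /=.
by split=> [[-> h]|/andP[-> /implyP]] //; apply/implyP.
Qed.

Lemma flex_linear cs :
  (forall a b, all (fun c => key c a == key c b) cs -> a = b) ->
  linear_order (fun a b => msat R (two_env a b) P (flex cs)).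
Proof.
move=> /lexF_linear[as_ tr to]; split=> [a b|a b c|a b]; rewrite !msat_flex //.
  exact: as_.
exact: tr.
Qed.

Lemma keyK_inj t a b : keyK t a = keyK t b -> {in ks, t a =1 t b}.
Proof. by move=> /bitval_inj e x xk; apply: (eq_in_map _ _ ks).2 xk; apply: e; rewrite !size_map. Qed.

Lemma key_crits s a b : all (fun c => key c a == key c b) (crits s) ->
  [/\ bedge a = bedge b, {in ks, bend a =1 bend b} &
      forall j, j < s -> bvcol j a = bvcol j b /\ {in ks, becol j a =1 becol j b}].
Proof.
have inj (x y : bool) : x = y :> nat -> x = y by case: x y => [] [].
rewrite /crits => /and3P[/eqP/inj e1 /eqP/keyK_inj e2 h]; split=> // j js.
have : j \in iota 0 s by rewrite mem_iota.
elim: (iota 0 s) h => //= i l IH /and3P[/eqP/inj e3 /eqP/keyK_inj e4 /IH h].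
by rewrite inE => /predU1P[->|].
Qed.

End Semantics.

(** * Edges, colour patterns and the exchange of twins *)

Lemma is_edgeP (G : sgraph) (e : {set 'I_(gn G)}) :
  reflect (exists x y, gadj G x y /\ e = [set x; y]) (is_edge e).
Proof.
apply: (iffP existsP) => [[x /existsP[y /andP[xy /eqP ->]]]|[x [y [xy ->]]]].
  by exists x, y.
by exists x; apply/existsP; exists y; rewrite xy eqxx.
Qed.

Lemma edge_ends (G : sgraph) (e : {set 'I_(gn G)}) x y :
  is_edge e -> x \in e -> y \in e -> x != y -> gadj G x y /\ e = [set x; y].
Proof.
case/is_edgeP=> u [v [uv ->]]; rewrite !inE.
by move=> /orP[]/eqP-> /orP[]/eqP->; rewrite ?eqxx // => _; split=> //;
  [rewrite gsym | rewrite setUC].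
Qed.

Lemma is_edge2 (G : sgraph) x y : gadj G x y -> is_edge [set x; y].
Proof. by move=> xy; apply/is_edgeP; exists x, y. Qed.

(** [None] stands for a vertex itself and [Some x] for its edge to [x]; [J] is the set of marks. *)
Definition patterns (T J : finType) (S : {set T}) : {set option T * J} :=
  setX (None |: [set Some x | x in S]) setT.

Lemma card_patterns (T J : finType) (S : {set T}) :
  #|patterns J S| = #|J| * #|S|.+1.
Proof.
rewrite cardsX cardsT mulnC cardsU1 card_imset; last by move=> ? ? [].
by case: imsetP => // -[].
Qed.

Lemma in_patterns (T J : finType) (S : {set T}) o j :
  ((o, j) \in patterns J S) = (if o is Some x then x \in S else true).
Proof.
rewrite !inE andbT; case: o => //= x; rewrite mem_imset //.
by move=> ? ? [].
Qed.

Section SwapTwins.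
Variables (G : sgraph) (u v : 'I_(gn G)).
Hypothesis twins : nbhd u = nbhd v.

Definition swap x := if x == u then v else if x == v then u else x.

Lemma swapK : involutive swap.
Proof.
move=> x; rewrite /swap; have [->|xu] := eqVneq x u.
  by rewrite eqxx; case: eqP.
by have [->|xv] := eqVneq x v; rewrite ?eqxx // (negPf xu) (negPf xv).
Qed.

Lemma twins_adj x : gadj G u x = gadj G v x.
Proof. by have /setP/(_ x) := twins; rewrite !inE. Qed.

Lemma swap_adjl x y : x != u -> x != v -> gadj G x (swap y) = gadj G x y.
Proof.
move=> xu xv; rewrite /swap; have [->|yu] := eqVneq y u.
  by rewrite gsym -twins_adj gsym.
by have [->|yv] := eqVneq y v; rewrite // gsym twins_adj gsym.
Qed.

Lemma swap_adj x y : gadj G (swap x) (swap y) = gadj G x y.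
Proof.
have adjuv : gadj G u v = false by rewrite twins_adj girr.
have adjvu : gadj G v u = false by rewrite gsym.
have [xuv|] := boolP ((x == u) || (x == v)); last first.
  by rewrite negb_or => /andP[xu xv]; rewrite {1}/swap (negPf xu) (negPf xv) swap_adjl.
have [yuv|] := boolP ((y == u) || (y == v)); last first.
  rewrite negb_or => /andP[yu yv]; rewrite {2}/swap (negPf yu) (negPf yv).
  by rewrite gsym swap_adjl // gsym.
rewrite /swap; case/orP: xuv => /eqP->; case/orP: yuv => /eqP->; rewrite ?eqxx;
  by have [e|//] := eqVneq v u; rewrite ?girr ?adjuv ?adjvu ?e ?girr.
Qed.

Lemma swap_edge (e : {set 'I_(gn G)}) : is_edge e -> is_edge (swap @: e).
Proof.
by case/is_edgeP=> x [y [xy ->]]; rewrite imsetU1 imset_set1; apply: is_edge2; rewrite swap_adj.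
Qed.

(** The default of [insubd] is never reached, since [swap] maps edges to edges. *)
Definition swap_univ (w : inc_univ G) : inc_univ G :=
  match w with inl x => inl (swap x) | inr e => inr (insubd e (swap @: val e)) end.

Lemma val_swap_edge (e : {e : {set 'I_(gn G)} | is_edge e}) :
  val (insubd e (swap @: val e)) = swap @: val e.
Proof. by rewrite val_insubd swap_edge ?(valP e). Qed.

Lemma swap_univK : involutive swap_univ.
Proof.
case=> [x|e] /=; first by rewrite swapK.
congr inr; apply: val_inj; rewrite !val_swap_edge -imset_comp.
by rewrite (eq_imset _ swapK) imset_id.
Qed.

Lemma swap_univ_rel a b : inc_rel (swap_univ a) (swap_univ b) = inc_rel a b.
Proof.
case: a b => [x|e] [y|f] //=; rewrite val_swap_edge mem_imset //.
exact: inv_inj swapK.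
Qed.

Variable Q : {set inc_univ G}.
Definition edge_in (e : {set 'I_(gn G)}) : bool :=
  [exists f : {e | is_edge e}, (val f == e) && (inr f \in Q)].

Lemma edge_inE (f : {e : {set 'I_(gn G)} | is_edge e}) :
  edge_in (val f) = (inr f \in Q).
Proof.
apply/existsP/idP => [[g /andP[/eqP/val_inj ->]]|fQ] //.
by exists f; rewrite eqxx.
Qed.

Hypothesis vcol : (inl u \in Q) = (inl v \in Q).
Hypothesis ecol : forall x, gadj G u x -> edge_in [set u; x] = edge_in [set v; x].

(** Edges avoiding both twins are fixed; an edge at one twin goes to the edge at the other with the
    same far end, of equal colour by [ecol]. *)
Lemma swap_univ_stable : swap_univ @: Q = Q.
Proof.
apply/setP=> w; rewrite -{1}[w]swap_univK mem_imset; last exact: inv_inj swap_univK.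
case: w => [x|e] /=.
  rewrite /swap; have [->//|xu] := eqVneq x u.
  by have [->|] := eqVneq x v.
rewrite -!edge_inE val_swap_edge; have [x [y [xy ->]]] := is_edgeP _ (valP e).
rewrite imsetU1 imset_set1.
(* Up to exchanging the ends, [x] is a twin; [y] is then fixed, as the twins are not adjacent. *)
wlog xuv : x y xy / (x == u) || (x == v).
  move=> W; have [xuv|] := boolP ((x == u) || (x == v)); first exact: W.
  have [yuv|] := boolP ((y == u) || (y == v)).
    by move=> _; rewrite setUC [in RHS]setUC; apply: W; rewrite // gsym.
  rewrite !negb_or => /andP[yu yv] /andP[xu xv].
  by rewrite /swap (negPf yu) (negPf yv) (negPf xu) (negPf xv).
have adjuv : gadj G u v = false by rewrite twins_adj girr.
have ux : gadj G u y by case/orP: xuv xy => /eqP->; rewrite ?twins_adj.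
have yu : y != u by apply: contraTneq ux => ->; rewrite girr.
have yv : y != v by apply: contraTneq ux => ->; rewrite adjuv.
rewrite {2}/swap (negPf yu) (negPf yv).
case/orP: xuv => /eqP->; rewrite /swap eqxx ?ecol //.
by have [->//|_] := eqVneq v u; rewrite ecol.
Qed.

End SwapTwins.

(** * From an order to SEP *)

Lemma orderable_ncomp_del_le (G : sgraph) k phi (S : {set 'I_(gn G)}) :
  is_split G -> mso_formula_xyZ k phi -> defines_order_on k phi (@inc_rel G) ->
  ncomp_del S <= (2 ^ (k.+1 * #|S|.+1)).+1.
Proof.
move=> [K [I [KI0 KIT Kc Is]]] wf [P [asym _ tot]].
apply: leq_trans (ncomp_del_le KI0 KIT Kc Is S) _; rewrite ltnS.
set A := [set v in I | _].
(* The marks are the [k] parameters together with adjacency, which gives the factor [k.+1] in the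
   exponent. *)
pose type (v : 'I_(gn G)) : {set option 'I_(gn G) * option 'I_k} :=
  [set p in patterns (option 'I_k) S | match p with
    | (None, None) => false
    | (None, Some i) => inl v \in P i
    | (Some x, None) => gadj G v x
    | (Some x, Some i) => edge_in (P i) [set v; x]
    end].
have typeE v o c : ((o, c) \in type v) =
    (if o is Some x then x \in S else true) && match o, c with
    | None, None => false
    | None, Some i => inl v \in P i
    | Some x, None => gadj G v x
    | Some x, Some i => edge_in (P i) [set v; x]
    end.
  by rewrite in_set in_patterns; case: o c => [?|] [?|].
have type_inj : {in A &, injective type}.
  move=> u v; rewrite !inE => /and3P[_ _ uS] /and3P[_ _ vS] /setP E.
  have twins : nbhd u = nbhd v.
    apply/setP=> x; have := E (Some x, None); rewrite !typeE !inE.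
    have [xS //|xS _] := boolP (x \in S).
    by apply/idP/idP => h; case/negP: xS; [apply: (subsetP uS)|apply: (subsetP vS)]; rewrite inE.
  have stab j : j < k -> P j = swap_univ u v @: P j.
    move=> jk; apply/esym/swap_univ_stable => //.
      by have := E (None, Some (Ordinal jk)); rewrite !typeE.
    move=> x ux; have := E (Some x, Some (Ordinal jk)).
    rewrite !typeE.
    by rewrite (subsetP uS) ?inE.
  (* The exchange of [u] and [v] preserves all parameters, so neither can strictly precede the
     other. *)
  have sym : msat (@inc_rel G) (two_env (inl u) (inl v)) P phi <->
             msat (@inc_rel G) (two_env (inl v) (inl u)) P phi.
    apply: (msat_automorphism (swap_univK twins) (swap_univ_rel twins) wf) => //.
    by case=> [|[|]] // _; rewrite /two_env /= /swap eqxx //; case: eqP => [->|].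
  suff [] : inl u = inl v :> inc_univ G by [].
  by case: (tot (inl u) (inl v)) => h; apply: asym => //; apply/sym.
rewrite -(card_in_imset type_inj).
have -> : 2 ^ (k.+1 * #|S|.+1) = #|powerset (patterns (option 'I_k) S)|.
  by rewrite card_powerset card_patterns card_option card_ord.
apply/subset_leq_card/subsetP=> _ /imsetP[v _ ->]; rewrite inE.
by apply/subsetP=> p; rewrite inE => /andP[].
Qed.

Lemma orderable_SEP (C : sgraph -> Prop) : (forall G, C G -> is_split G) ->
  MSO2_orderable C -> exists s, has_SEP C (fun n => 2 ^ (s * n.+1)).
Proof.
(* One more than [k.+1], to absorb the additional component. *)
move=> hs [k [phi [wf ord]]]; exists k.+2 => G CG n.
apply/bigmax_leqP=> S Sn.
(* On an empty structure no order is available, but there are no components either. *)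
have [U0|U0] := posnP #|inc_univ G|.
  rewrite (leq_trans (max_card _)) //.
  by move: U0; rewrite card_sum => /eqP; rewrite addn_eq0 => /andP[/eqP->].
apply: leq_trans (orderable_ncomp_del_le S (hs G CG) wf (ord G CG U0)) _.
have le : 2 ^ (k.+1 * #|S|.+1) <= 2 ^ (k.+1 * n.+1) by rewrite leq_exp2l // leq_mul2l ltnS Sn orbT.
have : 2 <= 2 ^ n.+1 by rewrite expnS leq_pmulr ?expn_gt0.
have : 0 < 2 ^ (k.+1 * n.+1) by rewrite expn_gt0.
rewrite [k.+2 * _]mulSn expnD; nia.
Qed.

(** * From SEP to an order *)

Definition twin_separating (G : sgraph) s
    (col : 'I_(gn G) -> {set option 'I_(gn G) * 'I_s}) :=
  forall u v, nbhd u = nbhd v ->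
    (forall j, ((None, j) \in col u) = ((None, j) \in col v)) ->
    (forall x j, x \in nbhd u -> ((Some x, j) \in col u) = ((Some x, j) \in col v)) ->
    u = v.

(** A twin class has at most as many members as its neighbourhood has sets of patterns; its i-th
    member receives the i-th set. *)
Lemma twin_separating_exists (G : sgraph) s :
  (forall S : {set 'I_(gn G)}, #|[set v | nbhd v == S]| <= 2 ^ (s * #|S|.+1)) ->
  exists col : 'I_(gn G) -> {set option 'I_(gn G) * 'I_s}, twin_separating col.
Proof.
move=> few; pose cls (S : {set 'I_(gn G)}) := enum [set v | nbhd v == S].
pose pats (S : {set 'I_(gn G)}) := enum (powerset (patterns 'I_s S)).
pose col v := nth set0 (pats (nbhd v)) (index v (cls (nbhd v))).
have in_cls v : v \in cls (nbhd v) by rewrite mem_enum inE.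
have lt v : index v (cls (nbhd v)) < size (pats (nbhd v)).
  rewrite -cardE card_powerset card_patterns card_ord.
  by apply: leq_trans (few _); rewrite [X in _ < X]cardE index_mem.
have sub v o j : (o, j) \in col v -> (o, j) \in patterns 'I_s (nbhd v).
  have := mem_nth set0 (lt v); rewrite -/(col v) mem_enum inE.
  by move=> /subsetP; apply.
exists col => u v uv eN eS.
have : col u = col v.
  apply/setP=> -[[x|] j]; last exact: eN.
  have [xu|xu] := boolP (x \in nbhd u); first exact: eS.
  (* Neither colouring has entries at vertices outside the common neighbourhood. *)
  by apply/idP/idP=> /sub; rewrite in_patterns -?uv (negPf xu).
rewrite /col -uv => /eqP; rewrite nth_uniq ?enum_uniq ?lt //; last by rewrite uv.
by move/eqP/(index_inj u (in_cls u)); apply; rewrite uv.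
Qed.

Section SplitOrder.
Variables (G : sgraph) (K I : {set 'I_(gn G)}).
Hypotheses (KI0 : K :&: I = set0) (KIT : K :|: I = setT).
Hypothesis Kclique : forall x y, x \in K -> y \in K -> x != y -> gadj G x y.
Hypothesis Istable : forall x y, x \in I -> y \in I -> ~~ gadj G x y.
Variables (s : nat) (col : 'I_(gn G) -> {set option 'I_(gn G) * 'I_s}).
Hypothesis colP : twin_separating col.

Let V := 'I_(gn G).
Let E := {e : {set V} | is_edge e}.
Let U := inc_univ G.
Let R : rel U := @inc_rel G.
Let rk (x : V) := index x (enum K).

Definition path_edges : {set U} :=
  [set w : U | if w is inr e then
     [exists u in K, exists v in K, (rk v == (rk u).+1) && (val e == [set u; v])]
   else false].

Definition colour_class (j : nat) : {set U} :=
  [set w : U | match w with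
   | inl v => [exists i : 'I_s, (i == j :> nat) && ((None, i) \in col v)]
   | inr e => [exists v : V, exists x : V, exists i : 'I_s,
       [&& v \notin K, x \in K, val e == [set v; x], i == j :> nat
         & (Some x, i) \in col v]]
   end].

(** Colour 0 is the whole universe, so [CECol 0] compares neighbourhoods; the colours from [col] are
    shifted by one. *)
Definition params (i : nat) : {set U} :=
  match i with
  | 0 => path_edges
  | 1 => [set w : U | if w is inl v then (v \in K) && (rk v == 0) else false]
  | 2 => [set w : U | if w is inl v then v \in K else false]
  | 3 => set0
  | 4 => setT
  | j.+4.+1 => colour_class j
  end.

Definition clique_seq : seq U := [seq inl x | x <- enum K].

Let inl_inj : injective (@inl V E).
Proof. by move=> x y []. Qed.

Lemma mem_clique_seq x : (inl x \in clique_seq) = (x \in K).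
Proof. by rewrite mem_map // mem_enum. Qed.

Lemma clique_seqP w : w \in clique_seq -> exists2 x, x \in K & w = inl x.
Proof. by case/mapP=> x; rewrite mem_enum; exists x. Qed.

Lemma index_clique_seq x : index (inl x : U) clique_seq = rk x.
Proof. exact: index_map. Qed.

Lemma clique_seq_uniq : uniq clique_seq.
Proof. by rewrite map_inj_uniq ?enum_uniq. Qed.

Lemma params2E w : (w \in params 2) = (w \in clique_seq).
Proof.
rewrite inE; case: w => [x|e]; first by rewrite mem_clique_seq.
by apply/esym/negP=> /clique_seqP[].
Qed.

Lemma params1E w : (w \in params 1) = (w \in clique_seq) && (index w clique_seq == 0).
Proof.
rewrite inE; case: w => [x|e]; first by rewrite mem_clique_seq index_clique_seq.
by apply/esym/negP=> /andP[/clique_seqP[]].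
Qed.

Lemma params0_le (e u w : U) : e \in params 0 -> R u e -> R w e ->
  w \in clique_seq /\ index w clique_seq <= (index u clique_seq).+1.
Proof.
rewrite inE; case: e u w => [//|e] [u|//] [w|//] /=.
case/existsP=> x /andP[xK /existsP[y /and3P[yK /eqP xy /eqP ->]]].
rewrite !inE !index_clique_seq mem_clique_seq.
by move=> /orP[]/eqP-> /orP[]/eqP->; split=> //; lia.
Qed.

Lemma params0_step (u w : U) : u \in clique_seq -> w \in clique_seq ->
  index w clique_seq = (index u clique_seq).+1 ->
  exists e, [/\ e \in params 0, R u e & R w e].
Proof.
move=> /clique_seqP[x xK ->] /clique_seqP[y yK ->]; rewrite !index_clique_seq => xy.
have ne : x != y by apply/eqP=> e; move: xy; rewrite e; lia.
exists (inr (Sub [set x; y] (is_edge2 (Kclique xK yK ne)))).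
rewrite /R /= inE !SubK !inE !eqxx orbT; split=> //.
apply/existsP; exists x; rewrite xK; apply/existsP; exists y.
by rewrite yK xy !eqxx.
Qed.

Lemma bedge_inc (a : U) : bedge R a = if a is inr _ then true else false.
Proof.
case: a => [x|e]; apply/existsP; first by case=> -[].
have [x [y [_ ee]]] := is_edgeP _ (valP e).
by exists (inl x); rewrite /R /= ee !inE eqxx.
Qed.

(** [v] is the one stable vertex that [fstable] attaches to [a]. *)
Definition rep (a : U) (v : V) := forall w, bstable R params w a = (w == inl v).

Lemma rep_vertex v : v \notin K -> rep (inl v) v.
Proof.
move=> vK w; rewrite /bstable bedge_inc params2E; case: w => [w|e]; last first.
  by rewrite andbF.
rewrite mem_clique_seq orbF !(inj_eq inl_inj).
by have [->|] := eqVneq w v; rewrite // vK.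
Qed.

Lemma rep_edge (e : E) x v : x \in K -> v \notin K -> val e = [set x; v] ->
  rep (inr e) v.
Proof.
move=> xK vK ee w; rewrite /bstable bedge_inc params2E; case: w => [w|f]; last first.
  by rewrite andbF.
rewrite mem_clique_seq /R /= ee !inE (inj_eq inl_inj).
have [->|wv] := eqVneq w v; first by rewrite vK orbT.
by have [->|] := eqVneq w x; rewrite ?xK // andbF.
Qed.

Lemma clique_stable_pair v x v' x' : v \notin K -> x \in K ->
  v' \notin K -> x' \in K -> [set v; x] = [set v'; x'] -> v = v' /\ x = x'.
Proof.
move=> vK xK vK' xK' /setP e; split.
  have := e v; rewrite !inE eqxx /= => /esym/orP[/eqP//|/eqP h].
  by case/negP: vK; rewrite h.
have := e x; rewrite !inE eqxx orbT => /esym/orP[/eqP h|/eqP//].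
by case/negP: vK'; rewrite -h.
Qed.

Lemma bvcol_rep a v (j : 'I_s) : rep a v ->
  bvcol R params j.+1 a = ((None, j) \in col v).
Proof.
move=> av; apply/existsP/idP => [[w]|jv].
  rewrite av => /andP[/eqP->]; rewrite inE => /existsP[i /andP[/eqP/val_inj ->]] //.
by exists (inl v); rewrite av eqxx inE; apply/existsP; exists j; rewrite eqxx.
Qed.

Lemma inc_pair (e : E) v x : v \notin K -> x \in K -> R (inl v) (inr e) ->
  R (inl x) (inr e) -> gadj G v x /\ val e = [set v; x].
Proof.
move=> vK xK ve xe; apply: edge_ends => //; first exact: valP.
by apply: contraNneq vK => ->.
Qed.

Lemma becol0_rep a v x : v \notin K -> x \in K -> rep a v ->
  becol R params 0 a (inl x) = gadj G v x.
Proof.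
move=> vK xK av; apply/existsP/idP => [[w /existsP[e]]|vx].
  rewrite av => /and4P[/eqP-> ve xe _].
  by case: e ve xe => // e ve xe; case: (inc_pair vK xK ve xe).
exists (inl v); apply/existsP; exists (inr (Sub [set v; x] (is_edge2 vx))).
by rewrite av /R /= !inE !eqxx orbT.
Qed.

Lemma becolS_rep a v x (j : 'I_s) : v \notin K -> x \in K -> gadj G v x -> rep a v ->
  becol R params j.+1 a (inl x) = ((Some x, j) \in col v).
Proof.
move=> vK xK vx av; apply/existsP/idP => [[w /existsP[e]]|jc].
  rewrite av => /and4P[/eqP-> ve xe].
  case: e ve xe => // e ve xe; have [_ ee] := inc_pair vK xK ve xe.
  rewrite inE => /existsP[v' /existsP[x' /existsP[i /and5P[vK' xK']]]].
  rewrite ee => /eqP/(clique_stable_pair vK xK vK' xK')[-> ->].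
  by move=> /eqP/val_inj->.
exists (inl v); apply/existsP; exists (inr (Sub [set v; x] (is_edge2 vx))).
rewrite av /R /= !inE !eqxx orbT /=.
apply/existsP; exists v; apply/existsP; exists x; apply/existsP; exists j.
by rewrite vK xK !eqxx.
Qed.

Lemma rep_inj a b v w : v \notin K -> w \notin K -> rep a v -> rep b w ->
  (forall j, j < s.+1 -> bvcol R params j a = bvcol R params j b /\
     {in clique_seq, becol R params j a =1 becol R params j b}) -> v = w.
Proof.
move=> vK wK av bw h.
have nK u x : u \notin K -> gadj G u x -> x \in K.
  rewrite -(in_stable_part KI0 KIT) => uI ux; rewrite -[_ \in K]negbK.
  by rewrite -(in_stable_part KI0 KIT); apply: contraTN ux => /(Istable uI).
have eN : nbhd v = nbhd w.
  apply/setP=> x; rewrite !inE; have [xK|xK] := boolP (x \in K).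
    have [_ /(_ (inl x))] := h 0 isT; rewrite mem_clique_seq => /(_ xK).
    by rewrite (becol0_rep vK xK av) (becol0_rep wK xK bw).
  by apply/idP/idP=> [/(nK _ _ vK)|/(nK _ _ wK)]; rewrite (negPf xK).
apply: colP => // [j|x j].
  by have [] := h j.+1 (ltn_ord j); rewrite (bvcol_rep j av) (bvcol_rep j bw).
move=> xv; have := xv; rewrite eN; move: xv; rewrite !inE => vx wx.
have xK := nK _ _ vK vx.
have [_ /(_ (inl x))] := h j.+1 (ltn_ord j); rewrite mem_clique_seq => /(_ xK).
by rewrite (becolS_rep j vK xK vx av) (becolS_rep j wK xK wx bw).
Qed.

Variant edge_shape (e : E) : Prop :=
| CliqueEdge x y of x \in K & y \in K & x != y & val e = [set x; y]
| CrossEdge x v of x \in K & v \notin K & val e = [set x; v].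

Lemma edge_shapeP e : edge_shape e.
Proof.
have [x [y [xy ee]]] := is_edgeP _ (valP e).
have [xK|xK] := boolP (x \in K); have [yK|yK] := boolP (y \in K).
- by apply: CliqueEdge xK yK _ ee; apply: contraTneq xy => ->; rewrite girr.
- exact: CrossEdge xK yK ee.
- by apply: CrossEdge yK xK _; rewrite setUC.
- by move: xy; rewrite (negPf (Istable _ _)) // (in_stable_part KI0 KIT).
Qed.

(** Ends in the clique determine clique vertices and clique edges. A stable vertex is its own
    representative; a crossing edge is its representative together with its clique end. *)
Lemma key_separates (a b : U) :
  all (fun c => key R params clique_seq c a == key R params clique_seq c b) (crits s.+1) ->
  a = b.
Proof.
case/key_crits; rewrite !bedge_inc => ab ends cols.
have endE x : x \in K -> bend R a (inl x) = bend R b (inl x).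
  by move=> xK; apply: ends; rewrite mem_clique_seq.
case: a b ab ends cols endE => [u|e] [v|f] // _ _ cols endE.
  have [uK|uK] := boolP (u \in K).
    by have := endE u uK; rewrite /bend /R /= !orbF eqxx => /esym/eqP.
  have [vK|vK] := boolP (v \in K).
    by have := endE v vK; rewrite /bend /R /= !orbF eqxx => /eqP ->.
  by congr inl; apply: rep_inj cols => //; apply: rep_vertex.
have {}endE x : x \in K -> (x \in val e) = (x \in val f) by move/endE.
congr inr; apply: val_inj.
case: (edge_shapeP e) (edge_shapeP f) => [x y xK yK xy ee|x v xK vK ee]
  [x' y' xK' yK' xy' ef|x' v' xK' vK' ef].
- apply/setP=> z; have [zK|zK] := boolP (z \in K); first exact: endE.
  rewrite ee ef !inE; have ne t : t \in K -> z == t = false.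
    by move=> tK; apply: contraNF zK => /eqP->.
  by rewrite !ne.
(* A clique edge has two ends in [K], a crossing edge only one. *)
- have inx t : t \in K -> t \in val e -> t = x'.
    move=> tK; rewrite endE // ef !inE => /orP[/eqP//|/eqP tv].
    by case/negP: vK'; rewrite -tv.
  by case/eqP: xy; apply: etrans (inx _ _ _) (esym (inx _ _ _)) => //; rewrite ee !inE eqxx ?orbT.
- have inx t : t \in K -> t \in val f -> t = x.
    move=> tK; rewrite -endE // ee !inE => /orP[/eqP//|/eqP tv].
    by case/negP: vK; rewrite -tv.
  by case/eqP: xy'; apply: etrans (inx _ _ _) (esym (inx _ _ _)) => //; rewrite ef !inE eqxx ?orbT.
have xx : x = x'.
  have := endE x xK; rewrite ee ef !inE eqxx => /esym/orP[/eqP//|/eqP tv].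
  by case/negP: vK'; rewrite -tv.
rewrite ee ef xx; congr [set _; _]; apply: rep_inj cols => //.
  exact: rep_edge ee.
exact: rep_edge ef.
Qed.

Lemma split_order_linear :
  linear_order (fun a b => msat R (two_env a b) params (flex (crits s.+1))).
Proof.
apply: (flex_linear clique_seq_uniq params2E params1E params0_le params0_step).
exact: key_separates.
Qed.

End SplitOrder.

Lemma SEP_orderable (C : sgraph -> Prop) s : (forall G, C G -> is_split G) ->
  has_SEP C (fun n => 2 ^ (s * n.+1)) -> MSO2_orderable C.
Proof.
(* Four reserved indices, the trivial colour 0, and [s] separating colours. *)
move=> hs sep; exists (4 + s.+1), (flex (crits s.+1)); split; first exact: crits_wf.
move=> G CG _; have [K [I [KI0 KIT Kc Is]]] := hs G CG.
have [S|col colP] := @twin_separating_exists G s.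
  apply: leq_trans (twins_le_ncomp_del S) (leq_trans _ (sep G CG #|S|)).
  exact: leq_bigmax_cond.
exists (params K col); exact: (split_order_linear KI0 KIT Kc Is colP).
Qed.

Theorem theorem4p31 (C : sgraph -> Prop) (hsplit : forall G, C G -> is_split G) :
  MSO2_orderable C <-> exists s : nat, has_SEP C (fun n => 2 ^ (s * n.+1)).
Proof.
split; first exact: orderable_SEP.
by case=> s; apply: SEP_orderable.
Qed.
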